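(* Consider the infinite, countable sequence of uncoupled systems $$\dot a_k=\Gamma_{kmn}(\lambda_m-\lambda_n)a_ma_n,\qquad \dot a_m=\Gamma_{kmn}(\lambda_n-\lambda_k)a_na_k,\qquad \dot a_n=\Gamma_{kmn}(\lambda_k-\lambda_m)a_ka_m,$$ for all $(k,m,n)=\gamma(\sigma_j(k^* ),\sigma_j(m^* ),\sigma_j(n^* ))$, $\gamma=\pm1,\pm2,\dots$, $0\le j\le3$. Under the conditions $\lambda_{n^*}-\lambda_{k^*}>0$, $\lambda_{k^*}-\lambda_{m^*}>0$, these resonant Euler systems admit a disjoint, countable family of homoclinic cycles. Moreover, under the conditions $\lambda_{n^*}\gg+1$, $\lambda_{m^*}\ll-1$, $|\lambda_{k^*}|\ll\lambda_{n^*}$, each subsystem possesses orbits whose $\mathbf{H}^s$ norms, $s\ge1$, burst arbitrarily large in arbitrarily small times.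
   Context: Setting: periodic lattice with parameters $\vartheta_1,\vartheta_2,\vartheta_3>0$ (for small scales in a cylinder of height $h$: $\vartheta_1=\vartheta_2=1$, $\vartheta_3=1/h^2$). $\mathbf{\Phi}_k$, $k\in\mathbf{Z}^3$, is a divergence-free curl eigenfunction of wavenumber $k$, $curl\,\mathbf{\Phi}_k=\lambda_k\mathbf{\Phi}_k$, $\lambda_k=\pm(\vartheta_1k_1^2+\vartheta_2k_2^2+\vartheta_3k_3^2)^{1/2}$ (signed by polarity), and $\Gamma_{kmn}=i\int(\mathbf{\Phi}_k\times\mathbf{\Phi}_m)\cdot\mathbf{\Phi}_n^*$, which is real. $\sigma_0=Id$ and $\sigma_j$ ($1\le j\le3$) changes the sign of the $j$-th component. $(k^*,m^*,n^* )$ is a triplet of relatively prime integer vectors with $k^*+m^*=n^*$, $k_3^*m_3^*n_3^*\neq0$, satisfying the three-wave resonance relation $\pm\frac{k_3^*}{|\lambda_{k^*}|}\pm\frac{m_3^*}{|\lambda_{m^*}|}\pm\frac{n_3^*}{|\lambda_{n^*}|}=0$ for some signs, irreducible (the $3\times3$ matrix with rows $(k_3^{*2},k_2^{*2},k_1^{*2})$, $(m_3^{*2},m_2^{*2},m_1^{*2})$, $(n_3^{*2},n_2^{*2},n_1^{*2})$ has nonzero determinant), with $\sigma_i(n^* )\neq n^*$ for $1\le i\le3$, and non-degenerate ($k^*_in^*_jm^*_l+k^*_lm^*_jn^*_i\neq0$ for every permutation $(i,j,l)$ of $(1,2,3)$). A homoclinic cycle here is an equivariant cycle formed by a pair of heteroclinic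 connections between the hyperbolic equilibria $a_k=\pm a_k(0)$, $a_m=a_n=0$ on an energy sphere. The $\mathbf{H}^s$ norm of an orbit is $\|a(t)\|_{H^s}^2=\lambda_k^{2s}a_k(t)^2+\lambda_m^{2s}a_m(t)^2+\lambda_n^{2s}a_n(t)^2$. Bursting arbitrarily large in arbitrarily small times means that the ratio $\|a(t)\|_{H^s}^2/\|a(0)\|_{H^s}^2$ exceeds any prescribed bound at some time $t>0$ smaller than any prescribed bound, for suitable orbits, provided the asymptotic conditions ($\gg$, $\ll$) hold strongly enough. *)

(* Defs.v *)
From HB Require Import structures.
From mathcomp Require Import all_boot all_order all_algebra perm complex.
From mathcomp Require Import all_classical all_reals all_analysis.

Set Implicit Arguments.
Unset Strict Implicit.
Unset Printing Implicit Defensive.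

Import Order.TTheory GRing.Theory Num.Theory.
Import numFieldNormedType.Exports.

Local Open Scope classical_set_scope.
Local Open Scope ring_scope.

(* Components 1, 2, 3 of the mathematical text are the indices 0, 1, 2 of
   'I_3; index arithmetic in 'I_3 is modulo 3. *)

(* A mode is a polarity (true = negative helicity) with a wavenumber. *)
Definition wavenumber := 'rV[int]_3.
Definition mode := (bool * wavenumber)%type.

(* sigma 0 = Id; for 1 <= j <= 3, sigma j flips the j-th component. *)
Definition sigma (j : 'I_4) (v : wavenumber) : wavenumber :=
  \row_i (if i.+1 == j :> nat then - v 0 i else v 0 i).

(* The subsystems are indexed by (gamma, j), gamma a nonzero integer. *)
Definition subsystem := ({g : int | g != 0} * 'I_4)%type.

(* Dilations and reflections act on the wavenumber; the polarity is kept, so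
   that lam (member i v) = `|gamma| * lam v. *)
Definition member (i : subsystem) (v : mode) : mode :=
  (v.1, val i.1 *: sigma i.2 v.2).

Section CurlModes.
Variables (R : realType) (theta : 'I_3 -> R).

Definition lam (v : mode) : R :=
  (-1) ^+ v.1 * Num.sqrt (\sum_i theta i * (v.2 0 i)%:~R ^+ 2).

Definition vfield := 'rV[R]_3 -> 'rV[R[i]]_3.

Definition partial (i : 'I_3) (f : 'rV[R]_3 -> R[i]) (x : 'rV[R]_3) : R[i] :=
  Complex ('D_(delta_mx 0 i) (fun y => complex.Re (f y)) x)
          ('D_(delta_mx 0 i) (fun y => complex.Im (f y)) x).

Definition divergence (F : vfield) (x : 'rV[R]_3) : R[i] :=
  \sum_i partial i (fun y => F y 0 i) x.

Definition curl (F : vfield) : vfield := fun x =>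
  \row_i (partial (i + 1) (fun y => F y 0 (i + 2)) x
          - partial (i + 2) (fun y => F y 0 (i + 1)) x).

Definition cross (u v : 'rV[R[i]]_3) : 'rV[R[i]]_3 :=
  \row_i (u 0 (i + 1) * v 0 (i + 2) - u 0 (i + 2) * v 0 (i + 1)).

(* c exp(i kappa.x) with kappa_j = sqrt(theta_j) k_j, which is periodic with
   respect to the box of sides 2 pi / sqrt(theta_j). *)
Definition plane_wave (k : wavenumber) (c : 'rV[R[i]]_3) : vfield := fun x =>
  let phase := \sum_i Num.sqrt (theta i) * (k 0 i)%:~R * x 0 i in
  Complex (cos phase) (sin phase) *: c.

Definition curl_eigenmode (v : mode) (F : vfield) : Prop :=
  [/\ exists2 c, c != 0 & F = plane_wave v.2 c,
      forall x, divergence F x = 0 &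
      forall x, curl F x = (lam v)%:C%C *: F x].

(* Integral over the periodicity box. *)
Definition box_integral (f : 'rV[R]_3 -> R) : R :=
  let side j : set R := `[0, 2 * pi / Num.sqrt (theta j)]%classic in
  let mu := @lebesgue_measure R in
  \int[mu]_(x in side 0) \int[mu]_(y in side 1) \int[mu]_(z in side 2)
    f (\row_i [:: x; y; z]`_i).

Definition box_integralC (f : 'rV[R]_3 -> R[i]) : R[i] :=
  Complex (box_integral (fun x => complex.Re (f x)))
          (box_integral (fun x => complex.Im (f x))).

Definition Gamma (Fk Fm Fn : vfield) : R[i] :=
  Complex 0 1 *
  box_integralC (fun x => \sum_i cross (Fk x) (Fm x) 0 i * conjc (Fn x 0 i)).

(* The triplet is relatively prime when no integer d > 1 divides all the
   components of its three vectors. *)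
Definition generic_resonant_triplet (k m n : mode) : Prop :=
  [/\ forall d : nat, (forall i,
        [&& (d %| k.2 0%R i)%Z, (d %| m.2 0%R i)%Z & (d %| n.2 0%R i)%Z]) -> d = 1%N,
      k.2 + m.2 = n.2 /\ k.2 0 2 * m.2 0 2 * n.2 0 2 != 0,
      exists ek em en : bool,
        (-1) ^+ ek * ((k.2 0 2)%:~R / `|lam k|)
        + (-1) ^+ em * ((m.2 0 2)%:~R / `|lam m|)
        + (-1) ^+ en * ((n.2 0 2)%:~R / `|lam n|) = 0,
      \det (\matrix_(i < 3, j < 3)
              ([:: k.2; m.2; n.2]`_i 0 (rev_ord j)) ^+ 2) != 0 /\
      (forall j : 'I_4, j != ord0 -> sigma j n.2 != n.2) &
      forall s : 'S_3,
        k.2 0 (s 0) * n.2 0 (s 1) * m.2 0 (s 2)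
        + k.2 0 (s 2) * m.2 0 (s 1) * n.2 0 (s 0) != 0].

(* Phi is a family of curl eigenfunctions, normalised in phase so that the
   coupling coefficients of all the subsystems are real. *)
Definition resonant_setting (Phi : mode -> vfield) (k m n : mode) : Prop :=
  [/\ forall i, 0 < theta i,
      forall v, v.2 != 0 -> curl_eigenmode v (Phi v),
      generic_resonant_triplet k m n &
      forall i, complex.Im (Gamma (Phi (member i k)) (Phi (member i m))
                                  (Phi (member i n))) = 0].

(* a = (a_k, a_m, a_n) *)
Definition euler_rhs (Phi : mode -> vfield) (k m n : mode) (a : 'rV[R]_3)
    : 'rV[R]_3 :=
  let g := complex.Re (Gamma (Phi k) (Phi m) (Phi n)) in
  \row_i [:: g * (lam m - lam n) * a 0 1 * a 0 2;
             g * (lam n - lam k) * a 0 2 * a 0 0;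
             g * (lam k - lam m) * a 0 0 * a 0 1]`_i.

(* s is real, lam^(2s) is (lam^2)^s. *)
Definition Hs_sqr (k m n : mode) (s : R) (a : 'rV[R]_3) : R :=
  (lam k ^+ 2) `^ s * a 0 0 ^+ 2 + (lam m ^+ 2) `^ s * a 0 1 ^+ 2
  + (lam n ^+ 2) `^ s * a 0 2 ^+ 2.

End CurlModes.

Section Dynamics.
Variable R : realType.
Implicit Types (V : 'rV[R]_3 -> 'rV[R]_3) (x : R -> 'rV[R]_3) (p q : 'rV[R]_3).

Definition solution V x : Prop := forall t : R, is_derive t 1 x (V (x t)).

Definition energy p : R := \sum_i p 0 i ^+ 2.

(* Equilibrium which is hyperbolic for the flow on its energy sphere: no
   eigenvalue of the linearisation restricted to the complexified tangent space
   of the sphere is purely imaginary. *)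
Definition sphere_hyperbolic V p : Prop :=
  V p = 0 /\
  forall (z : R[i]) (v : 'rV[R[i]]_3),
    v != 0 -> \sum_i v 0 i * (p 0 i)%:C%C = 0 ->
    v *m map_mx (real_complex R) (jacobian V p) = z *: v ->
    complex.Re z != 0.

Definition heteroclinic V p q x : Prop :=
  [/\ solution V x, forall t, energy (x t) = energy p,
      x @ -oo --> p & x @ +oo --> q].

(* Z consists of the equilibria (A, 0, 0) and (-A, 0, 0) and of two connections
   between them, exchanged by an orthogonal symmetry G of the system. *)
Definition homoclinic_cycle V (A : R) (Z : set 'rV[R]_3) : Prop :=
  let p := A *: delta_mx 0 0 in
  exists x y : R -> 'rV[R]_3,
    [/\ sphere_hyperbolic V p /\ sphere_hyperbolic V (- p),
        heteroclinic V p (- p) x, heteroclinic V (- p) p y,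
        exists G : 'M[R]_3,
          [/\ G *m G^T = 1%:M, forall a, V (a *m G) = V a *m G,
              p *m G = - p, (fun a => a *m G) @` range x = range y &
              (fun a => a *m G) @` range y = range x] &
        Z = [set p; - p] `|` range x `|` range y].

(* Embedding of the phase space of one triad into the phase space of all the
   mode amplitudes. *)
Definition embed (k m n : mode) p : mode -> R := fun v =>
  if v == k then p 0 0 else if v == m then p 0 1
  else if v == n then p 0 2 else 0.

End Dynamics.

(* Main.v *)
(* Idea. Each system is a free rigid body: writing b1 = Gamma (lam_n - lam_k) and
   b2 = Gamma (lam_k - lam_m), the k-axis is unstable as soon as b1 b2 > 0, and
   its two equilibria on a sphere are joined by the explicit orbits
     (-A tanh (w t), al sech (w t), be sech (w t)),   w^2 = A^2 b1 b2,
   which the half-turn about the m-axis maps to orbits going back. The phases of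
   the three plane waves cancel in Gamma, which is thus a nonzero multiple of a
   triple product of helical vectors; this product is proportional to
   lam_k + lam_m + lam_n and vanishes only if k, m, n are collinear, which
   irreducibility excludes. For the bursts, the orbit is started close to the
   k-axis and reaches a_k = 0 at time tau / 2, the amplitude A being used to
   accelerate it. *)

Require Import Defs.
From HB Require Import structures.
From mathcomp Require Import all_boot all_order all_algebra perm complex.
From mathcomp Require Import all_classical all_reals all_analysis.
From mathcomp Require Import ring lra zify.

Import Order.TTheory GRing.Theory Num.Theory.
Import numFieldNormedType.Exports.

Local Open Scope classical_set_scope.
Local Open Scope ring_scope.

Set Implicit Arguments.
Unset Strict Implicit.
Unset Printing Implicit Defensive.

(** * Vector algebra in dimension three and triple products of helical vectors *)

Notation dot u v := (\sum_i u ord0 i * v ord0 i).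

Lemma forall_ord3 (P : 'I_3 -> Prop) : P 0 -> P 1 -> P 2 -> forall i, P i.
Proof.
move=> P0 P1 P2 [[|[|[|//]]] lti].
- by rewrite (_ : Ordinal lti = 0) //; apply/val_inj.
- by rewrite (_ : Ordinal lti = 1) //; apply/val_inj.
- by rewrite (_ : Ordinal lti = 2) //; apply/val_inj.
Qed.

Lemma sum_ord3 (V : nmodType) (F : 'I_3 -> V) : \sum_i F i = F 0 + F 1 + F 2.
Proof.
rewrite !big_ord_recr big_ord0 /= add0r.
by congr (F _ + F _ + F _); apply/val_inj.
Qed.

Lemma row3P (T : Type) (u v : 'rV[T]_3) :
  u 0 0 = v 0 0 -> u 0 1 = v 0 1 -> u 0 2 = v 0 2 -> u = v.
Proof. by move=> h0 h1 h2; apply/rowP; apply: forall_ord3. Qed.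

(** With [N = p x q], the three vectors are [l N + im (r x N)] for [r = p, q, -(p + q)]. In the
    expansion of their determinant, terms with two factors [N] vanish, and so does the term with
    none, since the [r x N] are coplanar. The remaining terms each give [-l |N|^4], because
    consecutive [r] have the same cross product [N]. *)
Lemma helical_triple_identity (F : comNzRingType) (im p0 p1 p2 q0 q1 q2 a b c : F) :
  im * im = -1 ->
  let n0 := p1 * q2 - p2 * q1 in let n1 := p2 * q0 - p0 * q2 in
  let n2 := p0 * q1 - p1 * q0 in
  let h0 p0 p1 p2 l := l * n0 + im * (p1 * n2 - p2 * n1) in
  let h1 p0 p1 p2 l := l * n1 + im * (p2 * n0 - p0 * n2) in
  let h2 p0 p1 p2 l := l * n2 + im * (p0 * n1 - p1 * n0) in
  let u h := h p0 p1 p2 a : F in let v h := h q0 q1 q2 b : F in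
  let w h := h (- (p0 + q0)) (- (p1 + q1)) (- (p2 + q2)) c : F in
  (u h1 * v h2 - u h2 * v h1) * w h0 + (u h2 * v h0 - u h0 * v h2) * w h1
  + (u h0 * v h1 - u h1 * v h0) * w h2
  = - (a + b + c) * (n0 * n0 + n1 * n1 + n2 * n2) ^+ 2.
Proof. by move=> ii n0 n1 n2 /=; rewrite /n0 /n1 /n2; ring: ii. Qed.

Section HelicalAlgebra.
Context {R : realType}.
Implicit Types (u v w p q : 'rV[R[i]]_3) (l : R[i]).

Lemma crossE u v :
  (cross u v 0 0 = u 0 1 * v 0 2 - u 0 2 * v 0 1) *
  (cross u v 0 1 = u 0 2 * v 0 0 - u 0 0 * v 0 2) *
  (cross u v 0 2 = u 0 0 * v 0 1 - u 0 1 * v 0 0).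
Proof.
rewrite /cross !mxE.
by do !split; congr (u _ _ * v _ _ - u _ _ * v _ _); apply/val_inj.
Qed.

Lemma crossZr c u v : cross u (c *: v) = c *: cross u v.
Proof. by apply: row3P; rewrite !(crossE, mxE); ring. Qed.

Lemma cross_cross u v : cross u (cross u v) = dot v u *: u - dot u u *: v.
Proof.
by apply: row3P; rewrite !(crossE, sum_ord3, mxE); ring.
Qed.

Lemma cross_cross_cross p q u :
  cross (cross p q) (cross p u) = dot u (cross p q) *: p.
Proof.
by apply: row3P; rewrite !(crossE, sum_ord3, mxE); ring.
Qed.

Lemma dot_crossZ a b c u v w :
  dot (cross (a *: u) (b *: v)) (c *: w) = a * b * c * dot (cross u v) w.
Proof. by rewrite !sum_ord3 !crossE !mxE; ring. Qed.

(** An eigenvector of ['i p x _] is determined by its component along [N]: decompose [|N|^2 u] as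
    [(u.N) N - N x (N x u)], replace [l u] by ['i p x u] in the second term, and use
    [N x (p x u) = (u.N) p]. *)
Lemma helical_coord l p q u : let N := cross p q in
  'i *: cross p u = l *: u ->
  (l * dot N N) *: u = dot u N *: (l *: N + 'i *: cross p N).
Proof.
move=> N eig.
have -> : (l * dot N N) *: u = l *: (dot u N *: N - cross N (cross N u)).
  by rewrite cross_cross opprB addrC subrK scalerA.
rewrite scalerBr -(crossZr l N) -(crossZr l N) -eig crossZr cross_cross_cross.
by apply: row3P; rewrite !(mxE, crossE); ring.
Qed.

Lemma helical_triple p q u v w a b c : let N := cross p q in
  dot N N != 0 ->
  a != 0 -> b != 0 -> c != 0 -> u != 0 -> v != 0 -> w != 0 ->
  a ^+ 2 = dot p p -> b ^+ 2 = dot q q -> c ^+ 2 = dot (p + q) (p + q) ->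
  'i *: cross p u = a *: u -> 'i *: cross q v = b *: v ->
  'i *: cross (- (p + q)) w = c *: w ->
  dot (cross u v) w != 0.
Proof.
move=> N N0 a0 b0 c0 u0 v0 w0 ap bq cpq hu hv hw.
have ii : 'i * 'i = -1 :> R[i] by rewrite -expr2 sqrCi.
(* The pairs [(p, q)], [(q, -p)] and [(-(p + q), p)] share the cross product [N], so [helical_coord]
   describes all three eigenvectors by means of the same [N]. *)
have hq : cross q (- p) = N by apply: row3P; rewrite !(crossE,mxE); ring.
have hr : cross (- (p + q)) p = N.
  by apply: row3P; rewrite !(crossE,mxE); ring.
have Hu := @helical_coord _ p q _ hu.
have := @helical_coord _ q (- p) _ hv; rewrite hq => Hv.
have := @helical_coord _ (- (p + q)) p _ hw; rewrite hr => Hw.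
rewrite -/N /= in Hu Hv Hw.
have nz (x y z : 'rV[R[i]]_3) (l : R[i]) : l != 0 -> x != 0 ->
    (l * dot N N) *: x = dot x N *: (l *: y + 'i *: z) -> dot x N != 0.
  move=> l0 x0 E; apply: contra_neq x0 => z0; move/eqP: E.
  by rewrite z0 scale0r scaler_eq0 mulf_eq0 (negbTE l0) (negbTE N0) => /eqP.
(* If [c = -(a + b)], comparing squares gives [p.q = a b], and Lagrange's identity then yields
   [N.N = a^2 b^2 - (p.q)^2 = 0]. *)
have abc0 : a + b + c != 0.
  apply: contra_neq N0 => abc.
  have cE : c = - (a + b) by rewrite -[LHS]subr0 -abc; ring.
  have ab : dot p q = a * b.
    have : (2 : R[i]) != 0 by rewrite pnatr_eq0.
    move=> /mulfI; apply; transitivity (c ^+ 2 - a ^+ 2 - b ^+ 2).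
      by rewrite ap bq cpq !sum_ord3 !mxE; ring.
    by rewrite cE; ring.
  transitivity (dot p p * dot q q - dot p q ^+ 2).
    by rewrite !sum_ord3 !crossE; ring.
  by rewrite -ap -bq ab; ring.
suff: (a * dot N N) * (b * dot N N) * (c * dot N N) * dot (cross u v) w != 0.
  by apply: contra_neq => ->; rewrite mulr0.
rewrite -dot_crossZ Hu Hv Hw dot_crossZ.
rewrite !mulf_neq0 //; [exact: (nz _ _ _ _ a0 u0 Hu)
  |exact: (nz _ _ _ _ b0 v0 Hv)|exact: (nz _ _ _ _ c0 w0 Hw)|].
rewrite [X in X != 0](_ : _ = - (a + b + c) * dot N N ^+ 2); last first.
  have := @helical_triple_identity _ 'i (p 0 0) (p 0 1) (p 0 2)
    (q 0 0) (q 0 1) (q 0 2) a b c ii.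
  have coordE (r : 'rV[R[i]]_3) (l : R[i]) i :
      (l *: N + 'i *: cross r N) 0 i = l * N 0 i + 'i * cross r N 0 i.
    by rewrite mxE [X in X + _]mxE [X in _ + X]mxE.
  have NE : ((- (p + q)) 0 0 = - (p 0 0 + q 0 0)) *
      ((- (p + q)) 0 1 = - (p 0 1 + q 0 1)) *
      ((- (p + q)) 0 2 = - (p 0 2 + q 0 2)) by rewrite !mxE.
  have xE := coordE p a; have yE := coordE q b.
  have zE := coordE (- (p + q)) c.
  set x := a *: N + _ in xE *; set y := b *: N + _ in yE *.
  set z := c *: N + _ in zE *; clearbody x y z.
  by rewrite /= !sum_ord3 !crossE !xE !yE !zE /N !crossE !NE.
by rewrite mulf_neq0 ?oppr_eq0 ?expf_neq0.
Qed.

End HelicalAlgebra.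

(** * Plane waves: the curl becomes a cross product with the wavevector *)

Section PlaneWaves.
Context {R : realType}.
Variable theta : 'I_3 -> R.
Implicit Types (k m n : wavenumber) (c : 'rV[R[i]]_3) (f : 'rV[R]_3 -> R).

Definition kappa k : 'rV[R]_3 := \row_i (Num.sqrt (theta i) * (k 0 i)%:~R).

Definition kappaC k : 'rV[R[i]]_3 := map_mx (real_complex R) (kappa k).

Lemma derive_line f x v : 'D_v f x = 'D_1 (fun h : R => f (h *: v + x)) 0.
Proof.
rewrite /derive /=; apply: (congr1 (fun u : R -> R => lim (u @ 0^'))).
apply: boolp.funext => h /=.
by rewrite addr0 scale0r add0r [h *: 1]mulr1.
Qed.

Lemma phase_delta k (h : R) i :
  \sum_j Num.sqrt (theta j) * (k 0 j)%:~R * (h *: delta_mx 0 i + 0 : 'rV[R]_3) 0 j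
  = kappa k 0 i * h.
Proof.
rewrite (bigD1 i) //= big1 ?addr0 => [|j ji]; rewrite !mxE !eqxx.
  by rewrite mulr1.
by rewrite (negbTE ji) !mulr0.
Qed.

(** The function is the real part of [(a + i b) exp (i w h)]; replacing [(a, b)] by [(b, -a)] gives
    the imaginary part. *)
Lemma is_derive_trig (w a b : R) :
  is_derive (0 : R) 1 (fun h => cos (w * h) * a - sin (w * h) * b) (- (w * b)).
Proof.
have dw : is_derive (0 : R) 1 (fun h => w * h) w.
  have -> : (fun h : R => w * h) = w \*: (@id R) by [].
  by apply: (is_derive_eq (is_deriveZ w (is_derive_id _ _))); exact: mulr1.
have dc : is_derive (0 : R) 1 (fun h => cos (w * h)) 0.
  apply: (is_derive_eq (is_derive1_comp (is_derive_cos _) dw)).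
  by rewrite mulr0 sin0 oppr0 mul0r.
have ds : is_derive (0 : R) 1 (fun h => sin (w * h)) w.
  apply: (is_derive_eq (is_derive1_comp (is_derive_sin _) dw)).
  by rewrite mulr0 cos0 mul1r.
have -> : (fun h => cos (w * h) * a - sin (w * h) * b) =
  (a \*: (fun h => cos (w * h))) - (b \*: (fun h => sin (w * h))).
  by apply: boolp.funext => h; rewrite mulrC [sin _ * b]mulrC.
apply: (is_derive_eq (is_deriveB (is_deriveZ a dc) (is_deriveZ b ds))).
by rewrite scaler0 sub0r [b *: _]mulrC.
Qed.

Lemma partial_plane_wave k c i j :
  partial i (fun y => plane_wave theta k c y 0 j) 0 = 'i * kappaC k 0 i * c 0 j.
Proof.
rewrite /partial !derive_line /plane_wave.
set re := fun h => complex.Re _; set im := fun h => complex.Im _.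
have -> : re = fun h => cos (kappa k 0 i * h) * complex.Re (c 0 j)
                        - sin (kappa k 0 i * h) * complex.Im (c 0 j).
  by apply: boolp.funext => h; rewrite /re phase_delta mxE; case: (c 0 j).
have -> : im = fun h => cos (kappa k 0 i * h) * complex.Im (c 0 j)
                        - sin (kappa k 0 i * h) * - complex.Re (c 0 j).
  apply: boolp.funext => h; rewrite /im phase_delta mxE.
  by case: (c 0 j) => a b /=; rewrite mulrN opprK.
have [_ ->] :=
  is_derive_trig (kappa k 0 i) (complex.Re (c 0 j)) (complex.Im (c 0 j)).
have [_ ->] :=
  is_derive_trig (kappa k 0 i) (complex.Im (c 0 j)) (- complex.Re (c 0 j)).
rewrite -complexiE [kappaC k 0 i]mxE; case: (c 0 j) => a b /=.
by apply/eqP; rewrite eq_complex /=; apply/andP; split; apply/eqP; ring.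
Qed.

(** The eigenvalue equation is read at the origin, where the wave equals its amplitude [c] and each
    partial derivative is multiplication by ['i] times a component of the wavevector. *)
Lemma curl_eigenmode_helical v F : curl_eigenmode theta v F ->
  exists c, [/\ c != 0, F = plane_wave theta v.2 c &
    'i *: cross (kappaC v.2) c = (lam theta v)%:C%C *: c].
Proof.
case=> -[c c0 ->] _ eig; exists c; split=> //.
have {}eig := eig 0.
have P0 : plane_wave theta v.2 c 0 = c.
  rewrite /plane_wave big1 => [|i _]; last by rewrite mxE mulr0.
  by rewrite cos0 sin0 scale1r.
rewrite P0 in eig; rewrite -eig; apply/rowP => i.
by rewrite mxE [cross _ _ _ _]mxE [RHS]mxE !partial_plane_wave; ring.
Qed.

Lemma kappa_sqr k : (forall i, 0 < theta i) ->
  \sum_i kappa k 0 i ^+ 2 = \sum_i theta i * (k 0 i)%:~R ^+ 2.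
Proof.
by move=> th; apply: eq_bigr => i _; rewrite mxE exprMn sqr_sqrtr // ltW.
Qed.

Lemma lam_sqr v : (forall i, 0 < theta i) ->
  lam theta v ^+ 2 = \sum_i kappa v.2 0 i ^+ 2.
Proof.
move=> th; rewrite /lam exprMn sqrr_sign mul1r kappa_sqr // sqr_sqrtr //.
by apply: sumr_ge0 => i _; rewrite mulr_ge0 ?sqr_ge0 // ltW.
Qed.

Lemma lam_neq0 v : (forall i, 0 < theta i) -> v.2 != 0 -> lam theta v != 0.
Proof.
move=> th v0; rewrite -sqrf_eq0 lam_sqr // kappa_sqr //.
apply: contra_neq v0 => /eqP; rewrite psumr_eq0 => [/allP v0|i _]; last first.
  by rewrite mulr_ge0 ?sqr_ge0 // ltW.
apply/rowP => i; have := v0 i (mem_index_enum i).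
by rewrite mxE mulf_eq0 gt_eqF //= sqrf_eq0 intr_eq0 => /eqP.
Qed.

End PlaneWaves.

(** * Nonvanishing of the coupling coefficient *)

Section CouplingCoefficient.
Context {R : realType}.
Variable theta : 'I_3 -> R.
Hypothesis theta_gt0 : forall i, 0 < theta i.
Implicit Types (k m n : wavenumber) (a b c : 'rV[R[i]]_3).

Definition box_side i : R := 2 * pi / Num.sqrt (theta i).

Definition box_volume : R := box_side 0 * box_side 1 * box_side 2.

Lemma box_volume_gt0 : 0 < box_volume.
Proof.
have side_gt0 i : 0 < box_side i.
  by rewrite divr_gt0 ?sqrtr_gt0 // mulr_gt0 ?pi_gt0.
exact: (mulr_gt0 (mulr_gt0 (side_gt0 0) (side_gt0 1)) (side_gt0 2)).
Qed.

Lemma Rintegral_side (j : 'I_3) (r : R) :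
  \int[@lebesgue_measure R]_(_ in `[0, 2 * pi / Num.sqrt (theta j)]) r
  = r * (2 * pi / Num.sqrt (theta j)).
Proof.
rewrite Rintegral_cst; last exact: measurable_itv.
congr (_ * _).
rewrite [X in fine X](lebesgue_measure_itv `[0, 2 * pi / Num.sqrt (theta j)]).
rewrite /= lte_fin.
by rewrite divr_gt0 ?sqrtr_gt0 ?mulr_gt0 ?pi_gt0 //= subr0.
Qed.

Lemma box_integral_cst (r : R) : box_integral theta (fun=> r) = r * box_volume.
Proof.
by rewrite /box_integral /= !Rintegral_side /box_volume /box_side; ring.
Qed.

Lemma phaseD k m (x : 'rV[R]_3) :
  \sum_i Num.sqrt (theta i) * ((k + m) 0 i)%:~R * x 0 i
  = \sum_i Num.sqrt (theta i) * (k 0 i)%:~R * x 0 i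
    + \sum_i Num.sqrt (theta i) * (m 0 i)%:~R * x 0 i.
Proof.
by rewrite -big_split; apply: eq_bigr => i _ /=; rewrite mxE intrD; ring.
Qed.

Lemma cross_plane_waves k m a b c (x : 'rV[R]_3) :
  \sum_i cross (plane_wave theta k a x) (plane_wave theta m b x) 0 i
         * conjc (plane_wave theta (k + m) c x 0 i)
  = dot (cross a b) (map_mx conjc c).
Proof.
rewrite /plane_wave phaseD.
set s := (X in Complex (cos X)); set t := (X in _ + X).
pose e (u : R) := Complex (cos u) (sin u) : R[i].
transitivity (e s * e t * conjc (e (s + t)) * dot (cross a b) (map_mx conjc c)).
  rewrite -dot_crossZ; apply: eq_bigr => i _; congr (_ * _).
  by rewrite mxE rmorphM [RHS]mxE [in RHS]mxE.
rewrite -[RHS]mul1r; congr (_ * _).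
apply/eqP; rewrite eq_complex /= cosD sinD.
have cs u : sin u ^+ 2 = 1 - cos u ^+ 2 :> R by rewrite -(cos2Dsin2 u) addrC addKr.
have cu := cs s; have cv := cs t.
apply/andP; split; apply/eqP; move: cu cv;
  move: (cos s) (sin s) (cos t) (sin t) => x1 y1 x2 y2 h1 h2; ring: h1 h2.
Qed.

(** The phases cancel because the third wavenumber is [k + m]; the integrand is constant and the
    integral is its value times the volume of the box. *)
Lemma Gamma_plane_waves k m a b c :
  Gamma theta (plane_wave theta k a) (plane_wave theta m b)
    (plane_wave theta (k + m) c)
  = 'i * (box_volume%:C%C * dot (cross a b) (map_mx conjc c)).
Proof.
rewrite /Gamma -complexiE; congr (_ * _).
transitivity (box_integralC theta (fun=> dot (cross a b) (map_mx conjc c))).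
  congr (box_integralC theta _).
  by apply: boolp.funext => x; exact: cross_plane_waves.
rewrite /box_integralC !box_integral_cst; case: (dot _ _) => x y /=.
by apply/eqP; rewrite eq_complex /= !mul0r subr0 addr0 ![_ * box_volume]mulrC !eqxx.
Qed.

(** The product [dot] has no conjugation, but [N] is a real vector here, so [N.N = 0] is a vanishing
    sum of real squares. The factors [sqrt (theta i)] are then cancelled to return to integers. *)
Lemma cross_kappaC k m : let N := cross (kappaC theta k) (kappaC theta m) in
  dot N N = 0 -> forall i j, k 0 i * m 0 j = k 0 j * m 0 i.
Proof.
have E (x y z w : 'I_3) :
    kappaC theta k 0 x * kappaC theta m 0 y
      - kappaC theta k 0 z * kappaC theta m 0 w =
    (kappa theta k 0 x * kappa theta m 0 y
      - kappa theta k 0 z * kappa theta m 0 w)%:C%C.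
  by rewrite /kappaC ![map_mx _ _ _ _]mxE rmorphB !rmorphM.
rewrite /= sum_ord3 !crossE !E -!rmorphM -!rmorphD => /complexI.
have S (x y z : R) : x * x + y * y + z * z = 0 -> [/\ x = 0, y = 0 & z = 0].
  by move=> e; split; apply/eqP; rewrite -sqrf_eq0 eq_le sqr_ge0 andbT; nra.
have min i j : kappa theta k 0 i * kappa theta m 0 j
               - kappa theta k 0 j * kappa theta m 0 i = 0 ->
               k 0 i * m 0 j = k 0 j * m 0 i.
  rewrite !mxE => /eqP; rewrite subr_eq0 => /eqP e.
  apply/eqP; rewrite -(eqr_int R) !intrM; apply/eqP.
  have : Num.sqrt (theta i) * Num.sqrt (theta j) != 0.
    by rewrite mulf_neq0 ?gt_eqF ?sqrtr_gt0.
  by move=> /mulfI; apply; move: e; lra.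
case/S => /min h0 /min h1 /min h2.
by apply: forall_ord3; apply: forall_ord3.
Qed.

(** Conjugating the amplitude of the [n]-wave turns it into an eigenvector for the wavevector
    [-kappa n] with the same eigenvalue. The three wavevectors then sum to zero, as [helical_triple]
    requires. *)
Lemma triad_coupling_neq0 (Phi : mode -> vfield R) (k m n : mode) :
  curl_eigenmode theta k (Phi k) -> curl_eigenmode theta m (Phi m) ->
  curl_eigenmode theta n (Phi n) ->
  k.2 != 0 -> m.2 != 0 -> n.2 != 0 -> k.2 + m.2 = n.2 ->
  (exists ij : 'I_3 * 'I_3, k.2 0 ij.1 * m.2 0 ij.2 != k.2 0 ij.2 * m.2 0 ij.1) ->
  Gamma theta (Phi k) (Phi m) (Phi n) != 0.
Proof.
move=> /curl_eigenmode_helical[a [a0 -> ha]] /curl_eigenmode_helical[b [b0 -> hb]].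
move=> /curl_eigenmode_helical[c [c0 -> hc]] k0 m0 n0 kmn [[i j] /= minor].
rewrite -kmn Gamma_plane_waves !mulf_neq0 //.
- by rewrite neq0Ci.
- rewrite -[0](rmorph0 (real_complex R)) (inj_eq (@complexI _)).
  by rewrite gt_eqF ?box_volume_gt0.
have kD : kappaC theta n.2 = kappaC theta k.2 + kappaC theta m.2.
  by apply/rowP => l; rewrite -kmn !mxE intrD mulrDr rmorphD.
have lC v : v.2 != 0 -> (lam theta v)%:C%C != 0.
  move=> v0; rewrite -[0](rmorph0 (real_complex R)) (inj_eq (@complexI _)).
  exact: lam_neq0.
have lsq v : (lam theta v)%:C%C ^+ 2 = dot (kappaC theta v.2) (kappaC theta v.2).
  rewrite -rmorphXn lam_sqr // rmorph_sum; apply: eq_bigr => l _.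
  by rewrite [X in X * X]mxE -expr2 -rmorphXn.
apply: (@helical_triple _ (kappaC theta k.2) (kappaC theta m.2) a b _
  (lam theta k)%:C%C (lam theta m)%:C%C (lam theta n)%:C%C) => //; rewrite ?lC ?lsq ?kD //.
- by apply: contra_neq minor => /cross_kappaC.
- apply: contra_neq c0 => e; apply/rowP => l; move/rowP/(_ l)/eqP: e.
  by rewrite !mxE conjc_eq0 => /eqP.
rewrite -kD.
transitivity (map_mx conjc ('i *: cross (kappaC theta n.2) c)); last first.
  rewrite hc; apply/rowP => l; rewrite !mxE rmorphM.
  by congr (_ * _); exact: conjc_real.
have conjK l : conjc (kappaC theta n.2 0 l) = kappaC theta n.2 0 l.
  by rewrite !mxE conjc_real.
have conji : Complex 0 (-1) = - 'i :> R[i].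
  by rewrite -complexiE; apply/eqP; rewrite eq_complex /= oppr0 !eqxx.
have oppK l : (- kappaC theta n.2) 0 l = - kappaC theta n.2 0 l.
  by rewrite [LHS]mxE.
have conjE l : map_mx conjc c 0 l = conjc (c 0 l) by rewrite [LHS]mxE.
apply/rowP => l; rewrite mxE [cross _ _ _ _]mxE !oppK !conjE.
rewrite [RHS]mxE [X in _ = conjc X]mxE [cross _ _ _ _]mxE.
by rewrite rmorphM rmorphB !rmorphM /= !conjK conji; ring.
Qed.

End CouplingCoefficient.

(** * Arithmetic of the wavenumbers and of the family of subsystems *)

(** If [k] and [m] were parallel, their rows of squares would be proportional: the combination with
    coefficients [m_3^2], [-k_3^2] and [0] would vanish, and it is nontrivial since [k_3] is
    nonzero. *)
Lemma irreducible_minor (k m n : wavenumber) :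
  k 0 2 != 0 ->
  \det (\matrix_(i < 3, j < 3) ([:: k; m; n]`_i 0 (rev_ord j)) ^+ 2) != 0 ->
  exists ij : 'I_3 * 'I_3, k 0 ij.1 * m 0 ij.2 != k 0 ij.2 * m 0 ij.1.
Proof.
move=> k2; apply: contra_neqP => /boolp.forallNP minor.
have {}minor i j : k 0 i * m 0 j = k 0 j * m 0 i.
  by have /negP := minor (i, j); rewrite negbK => /eqP.
apply/eqP/det0P; exists (\row_i [:: m 0 2 ^+ 2; - k 0 2 ^+ 2; 0]`_i).
  apply: contra_neq k2 => /rowP/(_ 1); rewrite !mxE /= => /eqP.
  by rewrite oppr_eq0 sqrf_eq0 => /eqP.
apply/rowP => j; rewrite mxE sum_ord3 !mxE /= mul0r addr0 mulNr -!exprMn.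
by rewrite [X in X ^+ 2 - _]mulrC minor subrr.
Qed.

Definition reflection_sign (j : 'I_4) (i : 'I_3) : int :=
  if i.+1 == j :> nat then -1 else 1.

Lemma sqr_reflection_sign j i : reflection_sign j i ^+ 2 = 1.
Proof. by rewrite /reflection_sign; case: ifP; rewrite ?sqrrN expr1n. Qed.

Lemma memberE (i : subsystem) (v : mode) l :
  (member i v).2 0 l = val i.1 * reflection_sign i.2 l * v.2 0 l.
Proof.
rewrite /member /= !mxE /reflection_sign.
by case: ifP => _; rewrite ?mulr1 // mulrN1 mulNr mulrN.
Qed.

Lemma member_coef_neq0 (i : subsystem) l : val i.1 * reflection_sign i.2 l != 0.
Proof.
rewrite mulf_neq0 ?(valP i.1) // -sqrf_eq0 sqr_reflection_sign.
exact: oner_neq0.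
Qed.

(* No two of the four sign patterns are opposite, so gamma sigma_j determines j. *)
Lemma member_inj (i i' : subsystem) (v : mode) :
  (forall l, v.2 0 l != 0) -> member i v = member i' v -> i = i'.
Proof.
move=> v0 /(congr1 (fun w => w.2)) /rowP vE.
have {}vE l : val i.1 * reflection_sign i.2 l = val i'.1 * reflection_sign i'.2 l.
  by apply: (mulIf (v0 l)); rewrite -!memberE.
move: i i' vE => [[g g0] j] [[g' g'0] j'] /= vE.
suff: g = g' /\ j = j' :> nat.
  by case=> gg jj; apply/eqP; rewrite xpair_eqE -!val_eqE /= gg jj !eqxx.
have := (vE 0, vE 1, vE 2); rewrite /reflection_sign /=.
case: j j' {vE} => [[|[|[|[|//]]]] /= _] [[|[|[|[|//]]]] /= _];
  case=> -[] /=; rewrite ?mulrN1 ?mulr1; move/eqP: g0 => g0; lia.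
Qed.

(** * Eigenvalues and couplings of the subsystems *)

Section Triads.
Context {R : realType}.
Variables (theta : 'I_3 -> R) (Phi : mode -> vfield R) (k m n : mode).
Hypothesis setting : resonant_setting theta Phi k m n.
Implicit Types (i : subsystem).

Let theta_gt0 : forall l, 0 < theta l. Proof. by case: setting. Qed.

Lemma lam_member i v :
  lam theta (member i v) = `|val i.1|%:~R * lam theta v.
Proof.
rewrite /lam mulrCA; congr (_ * _).
rewrite -[X in X * _]ger0_norm ?ler0z // -sqrtr_sqr -sqrtrM ?sqr_ge0 //.
congr (Num.sqrt _); rewrite mulr_sumr; apply: eq_bigr => l _.
have sq : (reflection_sign i.2 l)%:~R ^+ 2 = 1 :> R.
  by rewrite -rmorphXn /= sqr_reflection_sign.
have nq : `|val i.1|%:~R ^+ 2 = (val i.1)%:~R ^+ 2 :> R.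
  by rewrite intr_norm real_normK ?num_real.
by rewrite memberE !intrM !exprMn nq sq; ring.
Qed.

Lemma member_gt0 i : 0 < `|val i.1|%:~R :> R.
Proof. by rewrite ltr0z normr_gt0 (valP i.1). Qed.

(** The coupling is a nonzero complex number with zero imaginary part. Passing to a member
    multiplies each 2 x 2 minor of [k] and [m] by nonzero integers, so noncollinearity is inherited
    from the original triplet. *)
Lemma coupling_neq0 i : complex.Re
  (Gamma theta (Phi (member i k)) (Phi (member i m)) (Phi (member i n))) != 0.
Proof.
have [_ eig [_ [kmn kmn0] _ [irr _] _] /(_ i) im0] := setting.
move: kmn0; rewrite !mulf_eq0 !negb_or => /andP[/andP[k0 m0] n0].
have member0 (v : mode) : v.2 0 2 != 0 -> (member i v).2 != 0.
  apply: contra_neq => /rowP/(_ 2)/eqP; rewrite memberE mxE mulf_eq0.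
  by rewrite (negbTE (member_coef_neq0 _ _)) => /eqP.
suff: Gamma theta (Phi (member i k)) (Phi (member i m)) (Phi (member i n)) != 0.
  by apply: contra_neq => re0; apply/eqP; rewrite eq_complex re0 im0 /= eqxx.
apply: (triad_coupling_neq0 theta_gt0); rewrite ?member0 //; try exact/eig/member0.
  by apply/rowP => l; rewrite mxE !memberE -kmn mxE mulrDr.
have [ij minor] := irreducible_minor k0 irr; exists ij; apply: contra_neq minor.
rewrite !memberE => e; apply: (mulfI (member_coef_neq0 i ij.1)).
apply: (mulfI (member_coef_neq0 i ij.2)); move: e.
move: (_ * reflection_sign _ _) (_ * reflection_sign _ _) => x y.
by lra.
Qed.

End Triads.

(** * Hyperbolic tangent and secant *)

Section HyperbolicFunctions.
Context {R : realType}.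
Implicit Types u : R.

Definition tanh u : R := (expR u - expR (- u)) / (expR u + expR (- u)).

Definition sech u : R := 2 / (expR u + expR (- u)).

Let den_gt0 u : 0 < expR u + expR (- u). Proof. by rewrite addr_gt0 ?expR_gt0. Qed.

Let den_neq0 u : expR u + expR (- u) != 0. Proof. by rewrite gt_eqF. Qed.

Lemma sech_gt0 u : 0 < sech u. Proof. by rewrite divr_gt0. Qed.

Lemma sech_neq0 u : sech u != 0. Proof. by rewrite gt_eqF ?sech_gt0. Qed.

Lemma sech0 : sech 0 = 1.
Proof. by rewrite /sech oppr0 expR0 divff. Qed.

Lemma tanh0 : tanh 0 = 0.
Proof. by rewrite /tanh oppr0 subrr mul0r. Qed.

Lemma sechN u : sech (- u) = sech u.
Proof. by rewrite /sech opprK addrC. Qed.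

Lemma tanhN u : tanh (- u) = - tanh u.
Proof. by rewrite /tanh opprK [_ + expR u]addrC -mulNr opprB. Qed.

Lemma tanh_sqrD u : tanh u ^+ 2 + sech u ^+ 2 = 1.
Proof.
have e1 := expRxMexpNx_1 u.
have := den_neq0 u; rewrite /tanh /sech; move: (expR u) (expR (- u)) e1.
move=> x y xy d; field: xy; exact: d.
Qed.

Lemma is_derive_tanh_sech u :
  is_derive u 1 tanh (sech u ^+ 2) /\ is_derive u 1 sech (- (sech u * tanh u)).
Proof.
have dN : is_derive u 1 (fun v => expR (- v)) (- expR (- u)).
  apply: (is_derive_eq (is_derive1_comp (is_derive_expR _) (is_deriveNid _ _))).
  by rewrite mulrN1.
have dD : is_derive u 1 (fun v => expR v + expR (- v)) (expR u - expR (- u)).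
  exact: (is_deriveD (is_derive_expR u) dN).
have dV := @is_deriveV _ (fun v => expR v + expR (- v)) _ _ _ (den_neq0 u) dD.
have e1 := expRxMexpNx_1 u.
have d := den_neq0 u.
split.
  have dB : is_derive u 1 (fun v => expR v - expR (- v)) (expR u - - expR (- u)).
    exact: (is_deriveB (is_derive_expR u) dN).
  apply: (is_derive_eq (is_deriveM dB dV)).
  rewrite /sech /GRing.scale /=; move: (expR u) (expR (- u)) d e1 => x y d xy.
  field: xy; exact: d.
apply: (is_derive_eq (is_deriveZ 2 dV)).
rewrite /sech /tanh /GRing.scale /=; move: (expR u) (expR (- u)) d => x y d.
field; exact: d.
Qed.

Lemma sech_le u : sech u <= 2 * expR (- u).
Proof.
rewrite expRN ler_pM2l // lef_pV2 ?posrE ?expR_gt0 //.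
by rewrite lerDl expR_ge0.
Qed.

Lemma cvg_sech_pinfty : sech u @[u --> +oo] --> (0 : R).
Proof.
apply: (@squeeze_cvgr _ _ _ _ (fun=> 0) (fun u => 2 * expR (- u))).
- by apply: nearW => u; rewrite sech_le ltW ?sech_gt0.
- exact: cvg_cst.
- by rewrite -[X in _ --> X](mulr0 2); apply: cvgMl_tmp; exact: cvgr_expR.
Qed.

Lemma cvg_tanh_pinfty : tanh u @[u --> +oo] --> (1 : R).
Proof.
(* This form avoids a quotient of two diverging exponentials. *)
have tanhE u : tanh u = 1 - expR (- u) * sech u.
  rewrite /tanh /sech; have := den_neq0 u.
  by move: (expR u) (expR (- u)) => x y d; field.
have -> : tanh = (fun=> 1) - (fun u => expR (- u) * sech u).
  by apply: boolp.funext => u; exact: tanhE.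
rewrite -[X in _ --> X]subr0 -[X in _ --> _ - X](mulr0 0).
apply: cvgB; first exact: cvg_cst.
by apply: cvgM; [exact: cvgr_expR|exact: cvg_sech_pinfty].
Qed.

Lemma cvg_sech_ninfty : sech u @[u --> -oo] --> (0 : R).
Proof.
apply/cvgNy_compNP; have -> : sech \o -%R = sech.
  by apply: boolp.funext => u /=; rewrite sechN.
exact: cvg_sech_pinfty.
Qed.

Lemma cvg_tanh_ninfty : tanh u @[u --> -oo] --> (- 1 : R).
Proof.
apply/cvgNy_compNP; have -> : tanh \o -%R = - tanh.
  by apply: boolp.funext => u /=; rewrite tanhN.
exact: cvgN cvg_tanh_pinfty.
Qed.

End HyperbolicFunctions.

(** * The triad vector field, its explicit orbits and its jacobian *)

Section TriadDynamics.
Context {R : realType}.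
Implicit Types (a : 'rV[R]_3) (A al be b w : R).

Lemma is_derive_row n (f : R -> 'rV[R]_n) (df : 'rV[R]_n) (t : R) :
  (forall i, is_derive t 1 (fun s => f s 0 i) (df 0 i)) -> is_derive t 1 f df.
Proof.
move=> dfi; have fi : derivable f t 1.
  by apply/derivable_mxP => i j; rewrite ord1; have [] := dfi j.
split=> //; rewrite derive_mx //; apply/rowP => j; rewrite mxE.
by have [_ <-] := dfi j.
Qed.

(** Euler's equations of the free rigid body; energy is conserved when [b0 + b1 + b2 = 0], a
    condition imposed separately where needed. *)
Definition triad_field (b0 b1 b2 : R) a : 'rV[R]_3 :=
  \row_i [:: b0 * a 0 1 * a 0 2; b1 * a 0 2 * a 0 0; b2 * a 0 0 * a 0 1]`_i.

Definition triad_orbit (A al be : R) (u : R) : 'rV[R]_3 :=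
  \row_i [:: - A * tanh u; al * sech u; be * sech u]`_i.

Lemma triad_orbitE A al be u :
  triad_orbit A al be u = (- A * tanh u) *: delta_mx 0 0
                          + sech u *: (\row_i [:: 0; al; be]`_i).
Proof. by apply: row3P; rewrite !mxE /=; ring. Qed.

(** The three relations match coefficients after differentiating with [tanh' = sech^2] and
    [sech' = - sech tanh]. The shift [t1] serves to place the crossing of [a_k = 0] at a chosen
    time. *)
Lemma solution_triad_orbit b0 b1 b2 A al be w t1 :
  - (w * A) = b0 * al * be -> w * al = b1 * A * be -> w * be = b2 * A * al ->
  solution (triad_field b0 b1 b2) (fun t => triad_orbit A al be (w * (t - t1))).
Proof.
move=> h0 h1 h2 t.
have dw : is_derive t 1 (fun s : R => w * (s - t1)) w.
  apply: (is_derive_eq (is_deriveZ w (is_deriveB (is_derive_id _ _) (is_derive_cst t1 _ _)))).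
  by rewrite subr0; exact: mulr1.
have [dT dS] := is_derive_tanh_sech (w * (t - t1)).
pose g s := w * (s - t1).
have dTw := @is_derive1_comp _ tanh g _ _ _ dT dw.
have dSw := @is_derive1_comp _ sech g _ _ _ dS dw.
apply: is_derive_row; apply: forall_ord3.
- have -> : (fun s => triad_orbit A al be (w * (s - t1)) 0 0)
      = (- A) \*: (tanh \o g).
    by apply: boolp.funext => s; rewrite mxE.
  apply: (is_derive_eq (is_deriveZ (- A) dTw)).
  rewrite !mxE /= /GRing.scale /=.
  by transitivity (- (w * A) * sech (w * (t - t1)) ^+ 2);
    [ring|rewrite h0; ring].
- have -> : (fun s => triad_orbit A al be (w * (s - t1)) 0 1)
      = al \*: (sech \o g).
    by apply: boolp.funext => s; rewrite mxE.
  apply: (is_derive_eq (is_deriveZ al dSw)).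
  rewrite !mxE /= /GRing.scale /=.
  by transitivity (w * al * - (sech (w * (t - t1)) * tanh (w * (t - t1))));
    [ring|rewrite h1; ring].
- have -> : (fun s => triad_orbit A al be (w * (s - t1)) 0 2)
      = be \*: (sech \o g).
    by apply: boolp.funext => s; rewrite mxE.
  apply: (is_derive_eq (is_deriveZ be dSw)).
  rewrite !mxE /= /GRing.scale /=.
  by transitivity (w * be * - (sech (w * (t - t1)) * tanh (w * (t - t1))));
    [ring|rewrite h2; ring].
Qed.

Lemma energy_triad_orbit A al be u :
  al ^+ 2 + be ^+ 2 = A ^+ 2 -> energy (triad_orbit A al be u) = A ^+ 2.
Proof.
move=> h; rewrite /energy sum_ord3 !mxE /=.
transitivity (A ^+ 2 * tanh u ^+ 2 + (al ^+ 2 + be ^+ 2) * sech u ^+ 2); first ring.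
by rewrite h -mulrDr tanh_sqrD mulr1.
Qed.

Lemma cvg_triad_orbit (F : set_system R) A al be (l : R) : Filter F ->
  tanh u @[u --> F] --> l -> sech u @[u --> F] --> (0 : R) ->
  triad_orbit A al be u @[u --> F] --> (- A * l) *: (delta_mx 0 0 : 'rV[R]_3).
Proof.
move=> FF hT hS.
have -> : triad_orbit A al be = (fun u => (- A * tanh u) *: delta_mx 0 0)
    + (fun u => sech u *: (\row_i [:: 0; al; be]`_i)).
  by apply: boolp.funext => u; exact: triad_orbitE.
have := cvgD (cvgZr_tmp (a := delta_mx 0 0 : 'rV[R]_3) (cvgMl_tmp (a := - A) hT))
  (cvgZr_tmp (a := \row_i [:: 0; al; be]`_i : 'rV[R]_3) hS).
by rewrite scale0r addr0; apply.
Qed.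

Lemma cvg_triad_orbit_ninfty A al be w : 0 < w ->
  triad_orbit A al be (w * t) @[t --> -oo] --> A *: (delta_mx 0 0 : 'rV[R]_3).
Proof.
move=> w0; have := @cvg_triad_orbit _ A al be _ _ cvg_tanh_ninfty cvg_sech_ninfty.
rewrite mulrNN mulr1=> cvgx.
have wy : w * t @[t --> -oo] --> -oo by apply: gt0_cvgMrNy.
exact: (cvg_comp _ _ wy (cvgx _)).
Qed.

Lemma cvg_triad_orbit_pinfty A al be w : 0 < w ->
  triad_orbit A al be (w * t) @[t --> +oo] --> - (A *: (delta_mx 0 0 : 'rV[R]_3)).
Proof.
move=> w0; have := @cvg_triad_orbit _ A al be _ _ cvg_tanh_pinfty cvg_sech_pinfty.
rewrite mulr1 scaleNr=> cvgx.
have wy : w * t @[t --> +oo] --> +oo by apply: gt0_cvgMry.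
exact: (cvg_comp _ _ wy (cvgx _)).
Qed.

(** Along a line, each component of the field is a constant times a product of two affine
    functions. *)
Lemma is_derive_quadratic (b x p y q : R) :
  is_derive (0 : R) 1 (fun h => b * (h * x + p) * (h * y + q)) (b * (x * q + p * y)).
Proof.
have dl (z r : R) : is_derive (0 : R) 1 (fun h => h * z + r) z.
  have -> : (fun h : R => h * z + r) = (z \*: (@id R)) + cst r.
    by apply: boolp.funext => h; rewrite mulrC.
  apply: (is_derive_eq (is_deriveD (is_deriveZ z (is_derive_id _ _)) (is_derive_cst r _ _))).
  by rewrite addr0; exact: mulr1.
have -> : (fun h => b * (h * x + p) * (h * y + q)) =
    b \*: ((fun h => h * x + p) * (fun h => h * y + q)).
  by apply: boolp.funext => h; rewrite -mulrA.
apply: (is_derive_eq (is_deriveZ b (is_deriveM (dl x p) (dl y q)))).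
by rewrite !mul0r !add0r /GRing.scale /=; ring.
Qed.

Lemma differentiable_triad_field b0 b1 b2 a : differentiable (triad_field b0 b1 b2) a.
Proof.
have dM (c : R) (i j : 'I_3) :
    differentiable (fun u : 'rV[R]_3 => c * u 0 i * u 0 j) a.
  by apply: differentiableM; [apply: differentiableM|]; try exact: differentiable_coord.
have -> : triad_field b0 b1 b2 = (fun u => (b0 * u 0 1 * u 0 2) *: delta_mx 0 0)
  + (fun u => (b1 * u 0 2 * u 0 0) *: delta_mx 0 1)
  + (fun u => (b2 * u 0 0 * u 0 1) *: delta_mx 0 2).
  apply: boolp.funext => u; rewrite /GRing.add /=.
  by apply: row3P; rewrite !mxE /= ?mulr1 ?mulr0 ?addr0 ?add0r.
by apply: differentiableD; [apply: differentiableD|]; exact: differentiableZl.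
Qed.

(** Vectors are rows: entry [(i, j)] is the derivative of component [j] in direction [i]. *)
Lemma jacobian_triad_field b0 b1 b2 a i j :
  jacobian (triad_field b0 b1 b2) a i j =
  [:: b0 * ((i == 1)%:R * a 0 2 + a 0 1 * (i == 2)%:R);
      b1 * ((i == 2)%:R * a 0 0 + a 0 2 * (i == 0)%:R);
      b2 * ((i == 0)%:R * a 0 1 + a 0 0 * (i == 1)%:R)]`_j.
Proof.
have dV := differentiable_triad_field b0 b1 b2 a.
transitivity ('D_(delta_mx 0 i) (triad_field b0 b1 b2) a 0 j).
  by rewrite deriveEjacobian // -rowE [RHS]mxE.
rewrite derive_mx; last exact: diff_derivable.
rewrite mxE derive_line.
have coordE (h : R) l : (h *: delta_mx 0 i + a) 0 l = h * (i == l)%:R + a 0 l.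
  by rewrite !mxE eqxx /= [l == _]eq_sym.
move: j; apply: forall_ord3.
- have [_ /= <-] := is_derive_quadratic b0 (i == 1)%:R (a 0 1) (i == 2)%:R (a 0 2).
  congr (derive _ _ _); apply: boolp.funext => h.
  by rewrite mxE /= !coordE.
- have [_ /= <-] := is_derive_quadratic b1 (i == 2)%:R (a 0 2) (i == 0)%:R (a 0 0).
  congr (derive _ _ _); apply: boolp.funext => h.
  by rewrite mxE /= !coordE.
- have [_ /= <-] := is_derive_quadratic b2 (i == 0)%:R (a 0 0) (i == 1)%:R (a 0 1).
  congr (derive _ _ _); apply: boolp.funext => h.
  by rewrite mxE /= !coordE.
Qed.

End TriadDynamics.

(** * Hyperbolicity and homoclinic cycles of a single triad *)

Section HomoclinicCycles.
Context {R : realType}.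
Implicit Types (A al be b w s : R) (a : 'rV[R]_3).

Lemma triad_field_axis b0 b1 b2 s : triad_field b0 b1 b2 (s *: delta_mx 0 0) = 0.
Proof. by apply: row3P; rewrite !mxE /= ?(mulr0, mul0r). Qed.

(** Tangent vectors have [v_0 = 0], and the linearisation exchanges the other two coordinates:
    [z v_1 = b1 s v_2] and [z v_2 = b2 s v_1]. An eigenvalue thus satisfies [z^2 = b1 b2 s^2 > 0],
    whereas [Re z = 0] would give [z^2 <= 0]. *)
Lemma triad_hyperbolic b0 b1 b2 s : s != 0 -> 0 < b1 * b2 ->
  sphere_hyperbolic (triad_field b0 b1 b2) (s *: delta_mx 0 0).
Proof.
move=> s0 b12; split; first exact: triad_field_axis.
move=> z v v0; rewrite sum_ord3 !mxE /= !(mulr0, addr0, mulr1) => /eqP.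
have C0 (r : R) : (r%:C%C == 0 :> R[i]) = (r == 0).
  by rewrite -[0](rmorph0 (real_complex R)) (inj_eq (@complexI _)).
rewrite mulf_eq0 C0 (negbTE s0) orbF => /eqP v00 eig.
have J i j : jacobian (triad_field b0 b1 b2) (s *: delta_mx 0 0) i j =
    [:: 0; b1 * ((i == 2)%:R * s); b2 * (s * (i == 1)%:R)]`_j.
  rewrite jacobian_triad_field !mxE /= !(mulr0, mul0r, mulr1, addr0, add0r).
  by [].
have eig1 : v 0 2 * (b1 * s)%:C%C = z * v 0 1.
  move/rowP/(_ 1): eig; rewrite !mxE sum_ord3 ![map_mx _ _ _ _]mxE !J /=.
  by rewrite !(mul0r, mulr0, mul1r, rmorph0, add0r).
have eig2 : v 0 1 * (b2 * s)%:C%C = z * v 0 2.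
  move/rowP/(_ 2): eig; rewrite !mxE sum_ord3 ![map_mx _ _ _ _]mxE !J /=.
  by rewrite !(mul0r, mulr0, mulr1, rmorph0, add0r, addr0).
apply: contra_neq v0 => z0.
have zsq : z ^+ 2 = (- complex.Im z ^+ 2)%:C%C.
  case: z z0 {eig eig1 eig2} => x y /= ->.
  by apply/eqP; rewrite eq_complex /= !(mul0r, mulr0, sub0r, addr0) !eqxx.
have v1 : v 0 1 = 0.
  have : v 0 1 * (- complex.Im z ^+ 2 - (b1 * b2) * s ^+ 2)%:C%C = 0.
    have -> : (- complex.Im z ^+ 2 - (b1 * b2) * s ^+ 2)%:C%C
        = z ^+ 2 - (b1 * s)%:C%C * (b2 * s)%:C%C.
      by rewrite zsq -rmorphM -rmorphB; congr (_ %:C%C); ring.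
    transitivity (z * (z * v 0 1) - (b1 * s)%:C%C * (v 0 1 * (b2 * s)%:C%C)); first ring.
    by rewrite -eig1 eig2; ring.
  have neg : - complex.Im z ^+ 2 - b1 * b2 * s ^+ 2 < 0.
    rewrite subr_lt0 (@le_lt_trans _ _ 0) ?oppr_le0 ?sqr_ge0 //.
    by rewrite mulr_gt0 // exprn_even_gt0.
  by move=> /eqP; rewrite mulf_eq0 C0 (lt_eqF neg) orbF => /eqP.
have v2 : v 0 2 = 0.
  move/eqP: eig1; rewrite v1 mulr0 mulf_eq0 C0 mulf_eq0 (negbTE s0) orbF.
  case/orP => /eqP // b10; move: b12; rewrite b10 mul0r ltxx //.
by apply: row3P; rewrite ?v00 ?v1 ?v2 mxE.
Qed.

(** The relations force [al^2 : be^2 = b1 : b2] with sum [A^2]. As [b1] and [b2] have the same sign,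
    [c = b1 + b2] is nonzero and both [b1 / c] and [b2 / c] are positive; the sign of [c] goes into
    [be]. The rate is [A sqrt (b1 b2)]. *)
Lemma orbit_parameters A b1 b2 : 0 < A -> 0 < b1 * b2 ->
  exists al be w, [/\ 0 < w, al != 0 /\ be != 0, al ^+ 2 + be ^+ 2 = A ^+ 2,
    w * al = b1 * A * be & w * be = b2 * A * al].
Proof.
move=> A0 b12; pose c := b1 + b2.
have c0 : c != 0.
  apply: contraTneq b12; rewrite /c -leNgt => c0.
  have -> : b2 = - b1 by lra.
  by rewrite mulrN oppr_le0; exact: sqr_ge0.
have [p0 q0] : 0 < b1 / c /\ 0 < b2 / c.
  have c2 : 0 < c ^+ 2 by rewrite exprn_even_gt0.
  have dE r : r / c = r * c / c ^+ 2 by rewrite expr2 invfM mulrA mulfK.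
  rewrite !dE !divr_gt0 //; rewrite /c.
    by have := sqr_ge0 b1; nra.
  by have := sqr_ge0 b2; nra.
have pqE : b1 / c + b2 / c = 1 by rewrite -mulrDl divff.
have [b1E b2E] : b1 = b1 / c * c /\ b2 = b2 / c * c by rewrite !divfK.
have sgE : `|c| = Num.sg c * c by rewrite normrEsg.
have sg1 : Num.sg c ^+ 2 = 1 by rewrite sqr_sg c0.
exists (A * Num.sqrt (b1 / c)), (Num.sg c * A * Num.sqrt (b2 / c)).
exists (A * `|c| * Num.sqrt (b1 / c) * Num.sqrt (b2 / c)).
have [sp sq] : Num.sqrt (b1 / c) ^+ 2 = b1 / c /\ Num.sqrt (b2 / c) ^+ 2 = b2 / c.
  by rewrite !sqr_sqrtr // ltW.
split.
- by rewrite !mulr_gt0 ?sqrtr_gt0 ?normr_gt0.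
- by rewrite !mulf_neq0 ?sgr_eq0 // ?gt_eqF ?sqrtr_gt0.
- by rewrite !exprMn sg1 sp sq mul1r -mulrDr pqE mulr1.
- transitivity (A ^+ 2 * `|c| * Num.sqrt (b1 / c) ^+ 2 * Num.sqrt (b2 / c)); first ring.
  by rewrite sp sgE [in RHS]b1E; ring.
- transitivity (A ^+ 2 * (Num.sg c * `|c|) * Num.sqrt (b1 / c) * Num.sqrt (b2 / c) ^+ 2).
    by ring.
  by rewrite sq -numEsg [in RHS]b2E; ring.
Qed.

(** The relation for [b0] follows from the other two: multiply it by [A] and use [A^2 = al^2 + be^2]
    and [b0 = -(b1 + b2)]. *)
Lemma triad_orbit_solution A al be w t1 b0 b1 b2 :
  A != 0 -> b0 + b1 + b2 = 0 -> al ^+ 2 + be ^+ 2 = A ^+ 2 ->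
  w * al = b1 * A * be -> w * be = b2 * A * al ->
  solution (triad_field b0 b1 b2) (fun t => triad_orbit A al be (w * (t - t1))).
Proof.
move=> A0 b00 AE h1 h2; apply: solution_triad_orbit => //.
apply: (mulfI A0).
have -> : A * - (w * A) = - (w * al * al + w * be * be).
  by transitivity (- w * A ^+ 2); [ring|rewrite -AE; ring].
have -> : b0 = - (b1 + b2) by lra.
by rewrite h1 h2; ring.
Qed.

(** This dichotomy between equilibria and connecting orbits is all that the disjointness argument
    retains of a cycle. *)
Definition axis_or_generic A (p : 'rV[R]_3) : Prop :=
  [/\ `|p 0 0| = A, p 0 1 = 0 & p 0 2 = 0] \/ (p 0 1 != 0 /\ p 0 2 != 0).

Lemma triad_homoclinic_cycle b0 b1 b2 A :
  b0 + b1 + b2 = 0 -> 0 < b1 * b2 -> 0 < A ->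
  exists Z, homoclinic_cycle (triad_field b0 b1 b2) A Z /\
    (forall p, Z p -> axis_or_generic A p).
Proof.
move=> b00 b12 A0.
have [al [be [w [w0 [al0 be0] AE h1 h2]]]] := orbit_parameters A0 b12.
pose p : 'rV[R]_3 := A *: delta_mx 0 0.
pose x t := triad_orbit A al be (w * t).
(* The half-turn about the m-axis commutes with the field because the product of any two of its
   signs is the third. *)
pose d : 'rV[R]_3 := \row_i [:: -1; 1; -1]`_i.
pose G : 'M[R]_3 := diag_mx d.
have GE a : a *m G = \row_i [:: - a 0 0; a 0 1; - a 0 2]`_i.
  by apply: row3P; rewrite mul_mx_diag !mxE /= ?(mulrN1, mulr1).
have GG : G *m G = 1%:M.
  rewrite /G mulmx_diag -diag_const_mx; congr diag_mx.
  by apply: row3P; rewrite !mxE /= ?mulrNN mulr1.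
have pG : p *m G = - p.
  by rewrite GE; apply: row3P; rewrite !mxE /= ?mulr0 ?oppr0 ?mulr1.
have VG a : triad_field b0 b1 b2 (a *m G) = triad_field b0 b1 b2 a *m G.
  by rewrite !GE; apply: row3P; rewrite !mxE /=; ring.
have An0 : A != 0 by rewrite gt_eqF.
have xsol : solution (triad_field b0 b1 b2) x.
  have := triad_orbit_solution 0 An0 b00 AE h1 h2.
  by under eq_fun do rewrite subr0.
pose y t := x t *m G.
(* The image orbit belongs to the same explicit family with [A] and [be] negated, so the same lemmas
   give its equation, energy and limits. *)
have yE : y = fun t => triad_orbit (- A) al (- be) (w * t).
  apply: boolp.funext => t; rewrite /y GE.
  by apply: row3P; rewrite !mxE /=; ring.
have AE' : al ^+ 2 + (- be) ^+ 2 = (- A) ^+ 2 by rewrite !sqrrN.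
have ysol : solution (triad_field b0 b1 b2) y.
  rewrite yE; under eq_fun do rewrite -[X in w * X]subr0.
  by apply: triad_orbit_solution; rewrite ?oppr_eq0 //; nra.
have pE : energy p = A ^+ 2.
  by rewrite /energy sum_ord3 !mxE /= !mulr0 mulr1 expr0n /= !addr0.
have xE t : energy (x t) = A ^+ 2 by exact: energy_triad_orbit.
exists ([set p; - p] `|` range x `|` range y); split; last first.
  move=> q [[[->|->]|[t _ <-]]|[t _ <-]].
  - by left; rewrite !mxE /= mulr0 mulr1 gtr0_norm.
  - by left; rewrite !mxE /= mulr0 mulr1 normrN oppr0 gtr0_norm.
  - by right; rewrite !mxE /=; split; apply: mulf_neq0 => //; exact: sech_neq0.
  - right; rewrite yE !mxE /=.
    by split; apply: mulf_neq0; rewrite ?oppr_eq0 //; exact: sech_neq0.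
exists x, y; split=> //.
- split; first by apply: triad_hyperbolic => //; rewrite gt_eqF.
  by rewrite -scaleNr; apply: triad_hyperbolic => //; rewrite oppr_eq0 gt_eqF.
- split=> //; first by move=> t; rewrite xE pE.
    exact: cvg_triad_orbit_ninfty.
  exact: cvg_triad_orbit_pinfty.
- split=> //.
  + move=> t; rewrite yE energy_triad_orbit // sqrrN -pE.
    by apply: eq_bigr => i _; rewrite [in RHS]mxE sqrrN.
  + rewrite yE -scaleNr; exact: cvg_triad_orbit_ninfty.
  + rewrite yE -[X in _ --> X]opprK -scaleNr; exact: cvg_triad_orbit_pinfty.
- exists G; split=> //; first by rewrite tr_diag_mx.
  + by rewrite eqEsubset; split=> [_ [_ [t _ <-] <-]|_ [t _ <-]];
      [exists t|exists (x t) => //; exists t].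
  + rewrite eqEsubset; split=> [_ [_ [t _ <-] <-]|_ [t _ <-]].
      by exists t => //; rewrite /y -mulmxA GG mulmx1.
    by exists (y t); [exists t|rewrite /y -mulmxA GG mulmx1].
Qed.

End HomoclinicCycles.

(** Supports are compared. An equilibrium is supported on [k] alone, with absolute value [A] there;
    any other point of a cycle has both [m] and [n] in its support, and [n] is the mode of the
    support with the largest [L]. The two kinds cannot coincide, and each one reveals its data. *)
Lemma embed_eq (R : realType) (L : mode -> R) (k m n k' m' n' : mode)
    (A A' : R) (p p' : 'rV[R]_3) :
  L m < L k -> L k < L n -> L m' < L k' -> L k' < L n' -> 0 < A ->
  axis_or_generic A p -> axis_or_generic A' p' ->
  embed k m n p = embed k' m' n' p' -> n = n' \/ (k = k' /\ A = A').
Proof.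
have coord (K M N : mode) (q : 'rV[R]_3) : L M < L K -> L K < L N ->
    [/\ embed K M N q K = q 0 0, embed K M N q M = q 0 1
      & embed K M N q N = q 0 2].
  move=> MK KN; have neq u v : L u < L v -> (u == v = false) * (v == u = false).
    by move=> uv; split; apply: contraTF uv => /eqP ->; rewrite ltxx.
  by rewrite /embed !eqxx !(neq _ _ MK) !(neq _ _ KN) !(neq _ _ (lt_trans MK KN)).
have axis_supp (K M N v : mode) (q : 'rV[R]_3) : q 0 1 = 0 -> q 0 2 = 0 ->
    embed K M N q v != 0 -> v = K.
  move=> q1 q2; rewrite /embed q1 q2; case: (v =P K) => // _.
  by rewrite !if_same eqxx.
have supp (K M N v : mode) (q : 'rV[R]_3) : L M < L K -> L K < L N ->
    embed K M N q v != 0 -> L v <= L N ?= iff (v == N).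
  move=> MK KN; have lt_leif u : L u < L N -> L u <= L N ?= iff (u == N).
    move=> uN; split; first exact: ltW.
    by rewrite lt_eqF //; apply/esym; apply: contraTF uN => /eqP ->; rewrite ltxx.
  rewrite /embed; case: (v =P K) => [-> _|_]; first exact: lt_leif.
  case: (v =P M) => [-> _|_]; first exact/lt_leif/(lt_trans MK).
  by case: (v =P N) => [-> _|_]; [split; rewrite ?eqxx|rewrite eqxx].
move=> mk kn mk' kn' A0 hp hp' E.
have [fk fm fn] := coord k m n p mk kn.
have [fk' fm' fn'] := coord k' m' n' p' mk' kn'.
case: hp => [[p0 p1 p2]|[p1 p2]]; case: hp' => [[p0' p1' p2']|[p1' p2']].
- right; have kk : k = k'.
    apply: (axis_supp k' m' n' k p' p1' p2').
    by rewrite -E fk -normr_eq0 p0 gt_eqF.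
  by split=> //; rewrite -p0 -p0' -fk -fk' E kk.
- have mk2 : m' = k by apply: (axis_supp k m n m' p p1 p2); rewrite E fm'.
  have nk2 : n' = k by apply: (axis_supp k m n n' p p1 p2); rewrite E fn'.
  by have := lt_trans mk' kn'; rewrite mk2 nk2 ltxx.
- have mk2 : m = k' by apply: (axis_supp k' m' n' m p' p1' p2'); rewrite -E fm.
  have nk2 : n = k' by apply: (axis_supp k' m' n' n p' p1' p2'); rewrite -E fn.
  by have := lt_trans mk kn; rewrite mk2 nk2 ltxx.
- left; have [nn' eq_nn'] := supp k' m' n' n p' mk' kn' (ltac:(by rewrite -E fn)).
  have [n'n _] := supp k m n n' p mk kn (ltac:(by rewrite E fn')).
  by apply/eqP; rewrite -eq_nn' eq_le nn' n'n.
Qed.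

(** * The disjoint family of homoclinic cycles *)

Section TriadCycles.
Context {R : realType}.
Variables (theta : 'I_3 -> R) (Phi : mode -> vfield R) (k m n : mode).
Hypothesis setting : resonant_setting theta Phi k m n.
Implicit Types (i : subsystem).

Let g i : R := complex.Re
  (Gamma theta (Phi (member i k)) (Phi (member i m)) (Phi (member i n))).

Lemma euler_rhsE i :
  euler_rhs theta Phi (member i k) (member i m) (member i n) =
  triad_field (g i * (lam theta (member i m) - lam theta (member i n)))
    (g i * (lam theta (member i n) - lam theta (member i k)))
    (g i * (lam theta (member i k) - lam theta (member i m))).
Proof. by []. Qed.

Lemma lam_member_lt i u v :
  lam theta u < lam theta v -> lam theta (member i u) < lam theta (member i v).
Proof. by move=> uv; rewrite !lam_member ltr_pM2l // member_gt0. Qed.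

(** The coupling enters squared, so its sign does not matter. *)
Lemma coupling_product_gt0 i :
  lam theta m < lam theta k -> lam theta k < lam theta n ->
  0 < g i * (lam theta (member i n) - lam theta (member i k))
      * (g i * (lam theta (member i k) - lam theta (member i m))).
Proof.
move=> /(lam_member_lt i) mk /(lam_member_lt i) kn.
rewrite mulrACA mulr_gt0 //; last by rewrite mulr_gt0 ?subr_gt0.
by rewrite -expr2 exprn_even_gt0 //= (coupling_neq0 setting).
Qed.

(** A zero component would make [n] fixed by the corresponding reflection. *)
Lemma n_components_neq0 l : n.2 0 l != 0.
Proof.
have [_ _ [_ _ _ [_ refl] _] _] := setting.
have lt4 : (l.+1 < 4)%N by rewrite ltnS ltn_ord.
apply: contraTneq (refl (Ordinal lt4) isT) => nl; rewrite negbK.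
apply/eqP/rowP => j; rewrite mxE /=; case: eqP => // /eqP.
by rewrite eqSS => /eqP /val_inj ->; rewrite nl oppr0.
Qed.

(** If two cycles meet, [embed_eq] leaves two cases. A common [n]-mode determines the index, since
    [n] has no zero component; a common [k]-mode with equal amplitudes is excluded for distinct
    indices by the choice of [A]. *)
Lemma disjoint_homoclinic_cycles (A : subsystem -> R) :
  0 < lam theta n - lam theta k -> 0 < lam theta k - lam theta m ->
  (forall i, 0 < A i) ->
  (forall i i', i != i' -> member i k = member i' k -> A i != A i') ->
  exists Z : subsystem -> set 'rV[R]_3,
    (forall i, homoclinic_cycle
       (euler_rhs theta Phi (member i k) (member i m) (member i n)) (A i) (Z i)) /\
    trivIset setT (fun i => embed (member i k) (member i m) (member i n) @` Z i).
Proof.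
rewrite !subr_gt0 => kn mk A0 Adiff.
have Zex i : exists Z, homoclinic_cycle
    (euler_rhs theta Phi (member i k) (member i m) (member i n)) (A i) Z /\
    (forall p, Z p -> axis_or_generic (A i) p).
  rewrite euler_rhsE; apply: triad_homoclinic_cycle => //; first by ring.
  exact: coupling_product_gt0.
exists (fun i => sval (cid (Zex i))); split=> [i|i i' _ _ [f]].
  by have [] := svalP (cid (Zex i)).
move=> [[p Zp <-] [p' Zp' E]].
have [_ /(_ _ Zp) hp] := svalP (cid (Zex i)).
have [_ /(_ _ Zp') hp'] := svalP (cid (Zex i')).
have [|[kk AA]] := embed_eq (lam_member_lt i mk) (lam_member_lt i kn)
  (lam_member_lt i' mk) (lam_member_lt i' kn) (A0 i) hp hp' (esym E).
  by apply: member_inj; exact: n_components_neq0.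
by apply/eqP; apply: contraTT isT => /Adiff /(_ kk); rewrite AA eqxx.
Qed.

End TriadCycles.

(** * Bursts of the Sobolev norms *)

(** The field is homogeneous of degree two, so scaling an orbit by [r] multiplies its rate by [r]:
    the orbit of amplitude 1 and rate [v] is scaled by [w / v]. *)
Lemma orbit_parameters_rate (R : realType) (b1 b2 w : R) : 0 < w -> 0 < b1 * b2 ->
  exists A al be, [/\ 0 < A, al ^+ 2 + be ^+ 2 = A ^+ 2,
    w * al = b1 * A * be & w * be = b2 * A * al].
Proof.
move=> w0 b12; have [al [be [v [v0 _ AE h1 h2]]]] := orbit_parameters ltr01 b12.
have vE : w = w / v * v by rewrite divfK // gt_eqF.
exists (w / v), (w / v * al), (w / v * be); split; first by rewrite divr_gt0.
- by rewrite !exprMn -mulrDr AE expr1n mulr1.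
- transitivity (w / v * (w / v) * (v * al)); first by rewrite {1}vE; ring.
  by rewrite h1; ring.
- transitivity (w / v * (w / v) * (v * be)); first by rewrite {1}vE; ring.
  by rewrite h2; ring.
Qed.

(** Since [C >= 4], [lk^2 <= ln^2 / 16], and the triangle-type inequality leaves
    [lm^2 >= 7/16 ln^2 >= ln^2 / 4]. *)
Lemma asymptotic_bounds (R : realType) (lk lm ln C : R) :
  4 <= C -> 0 < ln -> lm < 0 -> C * `|lk| <= ln ->
  ln ^+ 2 <= 2 * lk ^+ 2 + 2 * lm ^+ 2 ->
  [/\ - (ln / 4) <= lk, lk <= ln / 4 & ln / 2 <= - lm].
Proof.
move=> C4 n0 m0 kn nle.
have kl : `|lk| <= ln / 4.
  by rewrite ler_pdivlMr // mulrC (le_trans _ kn) // ler_wpM2r.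
have /andP[kl1 kl2] : - (ln / 4) <= lk <= ln / 4 by rewrite -ler_norml.
split=> //; rewrite -ler_sqr ?nnegrE; [|lra|lra].
have kn2 : 16 * lk ^+ 2 <= ln ^+ 2.
  have : 0 <= (ln / 4 - lk) * (ln / 4 + lk) by rewrite mulr_ge0 //; lra.
  by rewrite !expr2 => ?; lra.
by move: kn2 nle (sqr_ge0 ln); rewrite !expr2 => kn2 nle n2; lra.
Qed.

(* The orbit crosses the plane a_k = 0 at (0, al, be), where be carries at least
   1/12 of the energy; at the starting time the low mode k carries all but a
   fraction S^2 <= 1 / C^2 of it. *)
Lemma Hs_burst (R : realType) (lk lm ln C s A al be T S : R) :
  let hs (x y z : R) := (lk ^+ 2) `^ s * x ^+ 2 + (lm ^+ 2) `^ s * y ^+ 2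
                        + (ln ^+ 2) `^ s * z ^+ 2 in
  4 <= C -> 1 <= s -> 0 < ln -> lm < 0 -> C * `|lk| <= ln ->
  ln ^+ 2 <= 2 * lk ^+ 2 + 2 * lm ^+ 2 -> lm ^+ 2 <= 2 * lk ^+ 2 + 2 * ln ^+ 2 ->
  0 < A -> be ^+ 2 * (ln - lm) = A ^+ 2 * (lk - lm) ->
  T ^+ 2 + S ^+ 2 = 1 -> 0 < S -> C * S <= 1 ->
  C ^+ 2 / 13 <= hs 0 al be / hs (- A * T) (al * S) (be * S).
Proof.
move=> hs C4 s1 n0 m0 kn nle mle A0 beE TS S0 CS.
have kn2 : C ^+ 2 * lk ^+ 2 <= ln ^+ 2.
  by rewrite -[lk ^+ 2]real_normK ?num_real // -exprMn ler_sqr ?nnegrE ?mulr_ge0 //; lra.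
have C2 : 16 <= C ^+ 2 by nra.
have k2 := sqr_ge0 lk.
(* The factor 12 comes from [lk - lm >= ln / 4] and [ln - lm <= 3 ln]. *)
have be12 : A ^+ 2 <= 12 * be ^+ 2.
  have [kl1 kl2 m2] := asymptotic_bounds C4 n0 m0 kn nle.
  have m3 : - lm <= 2 * ln.
    by rewrite -ler_sqr ?nnegrE; [nra|lra|lra].
  have A2 : 0 < A ^+ 2 by rewrite exprn_gt0.
  have be2 : 0 <= be ^+ 2 by rewrite sqr_ge0.
  have : A ^+ 2 * (ln / 4) <= be ^+ 2 * (3 * ln).
    apply: (@le_trans _ _ (A ^+ 2 * (lk - lm))).
      by rewrite ler_wpM2l //; lra.
    by rewrite -beE ler_wpM2l //; lra.
  by move=> h; rewrite -(ler_pM2r n0); lra.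
pose Q := (lm ^+ 2) `^ s * al ^+ 2 + (ln ^+ 2) `^ s * be ^+ 2.
have QE : hs 0 al be = Q by rewrite /hs /Q expr0n /= mulr0 add0r.
have hsE : hs (- A * T) (al * S) (be * S)
    = (lk ^+ 2) `^ s * A ^+ 2 * T ^+ 2 + S ^+ 2 * Q by rewrite /hs /Q; ring.
(* Here [s >= 1] enters, through [C^2 <= (C^2)^s]. *)
have Ps : C ^+ 2 * (lk ^+ 2) `^ s <= (ln ^+ 2) `^ s.
  have s0 : 0 <= s by lra.
  apply: (@le_trans _ _ ((C ^+ 2 * lk ^+ 2) `^ s)); last first.
    apply: ge0_ler_powR => //; rewrite nnegrE; last exact: sqr_ge0.
    by apply: mulr_ge0; exact: sqr_ge0.
  rewrite powRM ?sqr_ge0 // ler_wpM2r ?powR_ge0 //.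
  rewrite -[X in X <= _](powRr1 (sqr_ge0 C)); apply: ler_powR => //; lra.
have Qn : (ln ^+ 2) `^ s * A ^+ 2 <= 12 * Q.
  have h1 := powR_ge0 (ln ^+ 2) s.
  have h2 : 0 <= (lm ^+ 2) `^ s * al ^+ 2 by rewrite mulr_ge0 ?powR_ge0 ?sqr_ge0.
  have := ler_wpM2l h1 be12; rewrite /Q; lra.
have Q0 : 0 < Q.
  suff: 0 < (ln ^+ 2) `^ s * A ^+ 2 by lra.
  by rewrite mulr_gt0 ?powR_gt0 ?exprn_gt0.
have S2 : 0 < S ^+ 2 by rewrite exprn_gt0.
have CS2 : C ^+ 2 * S ^+ 2 <= 1.
  by rewrite -exprMn -[leRHS](expr1n _ 2) ler_sqr ?nnegrE ?mulr_ge0 //; lra.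
have A2 : 0 <= A ^+ 2 by rewrite sqr_ge0.
have P0 : 0 <= (lk ^+ 2) `^ s * A ^+ 2 by rewrite mulr_ge0 ?powR_ge0.
have T2 := sqr_ge0 T.
have D0 : 0 < (lk ^+ 2) `^ s * A ^+ 2 * T ^+ 2 + S ^+ 2 * Q.
  by rewrite ltr_wpDl ?mulr_gt0 // mulr_ge0.
rewrite QE hsE ler_pdivlMr // mulrAC ler_pdivrMr; last lra.
(* The two parts of the initial norm, multiplied by [C^2], are at most [Q] and [12 Q], whence the
   13. *)
have e1 : C ^+ 2 * (S ^+ 2 * Q) <= Q.
  by rewrite mulrA -[leRHS]mul1r ler_wpM2r // ltW.
have e2 : C ^+ 2 * ((lk ^+ 2) `^ s * A ^+ 2 * T ^+ 2) <= 12 * Q.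
  apply: (@le_trans _ _ (C ^+ 2 * ((lk ^+ 2) `^ s * A ^+ 2))).
    rewrite ler_wpM2l ?sqr_ge0 // -[leRHS]mulr1 ler_wpM2l //; lra.
  by rewrite mulrA (le_trans _ Qn) // ler_wpM2r.
by rewrite mulrDr; lra.
Qed.

Section Bursts.
Context {R : realType}.
Variables (theta : 'I_3 -> R) (Phi : mode -> vfield R) (k m n : mode).
Hypothesis setting : resonant_setting theta Phi k m n.
Implicit Types (i : subsystem).

Let theta_gt0 : forall l, 0 < theta l. Proof. by case: setting. Qed.

Lemma lam_sqr_triangle (u v w : mode) : (forall l, w.2 0 l = u.2 0 l + v.2 0 l) ->
  lam theta w ^+ 2 <= 2 * lam theta u ^+ 2 + 2 * lam theta v ^+ 2.
Proof.
move=> uvw; rewrite !lam_sqr // !mulr_sumr -big_split /=.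
apply: ler_sum => l _; rewrite !mxE uvw intrD mulrDr.
move: (_ * _) (_ * _) => x y; have := sqr_ge0 (x - y); nra.
Qed.

Lemma lam_sqr_member i :
  lam theta (member i n) ^+ 2
    <= 2 * lam theta (member i k) ^+ 2 + 2 * lam theta (member i m) ^+ 2 /\
  lam theta (member i m) ^+ 2
    <= 2 * lam theta (member i k) ^+ 2 + 2 * lam theta (member i n) ^+ 2.
Proof.
have [_ _ [_ [kmn _] _ _ _] _] := setting.
split; first by apply: lam_sqr_triangle => l; rewrite !memberE -kmn mxE mulrDr.
(* The second bound is the first argument applied to [m = -k + n]; [-k] has the same squared
   eigenvalue as [k]. *)
have := @lam_sqr_triangle (k.1, - (member i k).2) (member i n) (member i m).
rewrite (_ : lam theta (k.1, - (member i k).2) ^+ 2 = lam theta (member i k) ^+ 2).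
  apply=> l; rewrite /= [X in _ = X + _]mxE !memberE -kmn.
  by rewrite [X in _ = _ + _ * X]mxE; ring.
rewrite !lam_sqr //; apply: eq_bigr => l _.
by rewrite !mxE intrN mulrN sqrrN.
Qed.

Lemma bursting_orbit (C tau : R) i :
  0 < tau -> 4 <= C ->
  C <= lam theta n -> lam theta m <= - C -> C * `|lam theta k| <= lam theta n ->
  exists2 a : R -> 'rV[R]_3,
    solution (euler_rhs theta Phi (member i k) (member i m) (member i n)) a &
    forall s : R, 1 <= s -> exists2 t : R, 0 < t < tau &
      C ^+ 2 / 13 <= Hs_sqr theta (member i k) (member i m) (member i n) s (a t)
             / Hs_sqr theta (member i k) (member i m) (member i n) s (a 0).
Proof.
move=> tau0 C4 Cn mC Ckn.
(* The asymptotic conditions already imply the ordering of the eigenvalues under which the explicit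
   orbits exist. *)
have [kl kr] : lam theta m < lam theta k /\ lam theta k < lam theta n.
  have nle : lam theta n ^+ 2 <= 2 * lam theta k ^+ 2 + 2 * lam theta m ^+ 2.
    have [_ _ [_ [kmn _] _ _ _] _] := setting.
    by apply: lam_sqr_triangle => l; rewrite -kmn mxE.
  have [] := asymptotic_bounds C4 _ _ Ckn nle; [lra|lra|].
  by move=> *; split; lra.
have b12 := coupling_product_gt0 setting i kl kr.
(* With this rate, half the time [tau] corresponds to the argument [2 C] of [tanh] and [sech]. *)
pose w := 4 * C / tau.
have w0 : 0 < w by rewrite divr_gt0 // mulr_gt0 //; lra.
have [A [al [be [A0 AE h1 h2]]]] := orbit_parameters_rate w0 b12.
exists (fun t => triad_orbit A al be (w * (t - tau / 2))).
  rewrite euler_rhsE; apply: triad_orbit_solution => //; [by rewrite gt_eqF|ring].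
move=> s s1; exists (tau / 2); first by apply/andP; split; lra.
have lt0 : lam theta (member i m) < 0.
  by rewrite lam_member pmulr_rlt0 ?member_gt0 //; lra.
have gt0 : 0 < lam theta (member i n).
  by rewrite lam_member pmulr_rgt0 ?member_gt0 //; lra.
have Ckn' : C * `|lam theta (member i k)| <= lam theta (member i n).
  rewrite !lam_member normrM (gtr0_norm (member_gt0 i)) mulrCA.
  by rewrite ler_pM2l // member_gt0.
have [t1 t2] := lam_sqr_member i.
have u2C : w * (0 - tau / 2) = - (2 * C).
  by rewrite /w; field; rewrite gt_eqF.
rewrite subrr mulr0 u2C /Hs_sqr !mxE /= tanh0 sech0 mulr0 !mulr1.
apply: Hs_burst => //; [|exact: tanh_sqrD|exact: sech_gt0|].
  set g := complex.Re _ in h1 h2.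
  have gA : g * A != 0 by rewrite mulf_neq0 ?(coupling_neq0 setting) ?gt_eqF.
  (* Both sides come from computing [w al be] with each of the two relations. *)
  have alE : be ^+ 2 * (lam theta (member i n) - lam theta (member i k))
      = al ^+ 2 * (lam theta (member i k) - lam theta (member i m)).
    apply: (mulfI gA); transitivity (w * al * be); first by rewrite h1; ring.
    by transitivity (w * be * al); [ring|rewrite h2; ring].
  by rewrite -AE; move: alE; lra.
(* The bound [C sech (2 C) <= 1] follows from [sech u <= 2 exp (-u)] and [exp (2 C) >= 1 + 2 C]. *)
rewrite sechN (le_trans (ler_wpM2l _ (sech_le _))) //; first lra.
rewrite expRN mulrA mulrC ler_pdivrMl ?expR_gt0 // mulr1.
by have := expR_ge1Dx (2 * C); lra.
Qed.

End Bursts.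

(* In the first part, A i is the amplitude a_k(0) of the cycle of the i-th
   subsystem.  It is arbitrary, except that two subsystems with the same
   k-mode (which occurs when a component of k vanishes) are placed on different
   energy spheres, as their cycles would otherwise share their equilibria.
   In the second part, C measures the strength of the asymptotic conditions. *)
Theorem corollary4p6 (R : realType) :
  (forall (theta : 'I_3 -> R) (Phi : mode -> vfield R) (k m n : mode),
     resonant_setting theta Phi k m n ->
     0 < lam theta n - lam theta k ->
     0 < lam theta k - lam theta m ->
     forall A : subsystem -> R,
       (forall i, 0 < A i) ->
       (forall i i', i != i' -> member i k = member i' k -> A i != A i') ->
       exists Z : subsystem -> set 'rV[R]_3,
         (forall i, homoclinic_cycle
            (euler_rhs theta Phi (member i k) (member i m) (member i n))
            (A i) (Z i)) /\
         trivIset setT (fun i =>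
           embed (member i k) (member i m) (member i n) @` Z i)) /\
  (forall M tau : R, 0 < tau -> exists2 C : R, 0 < C &
     forall (theta : 'I_3 -> R) (Phi : mode -> vfield R) (k m n : mode),
       resonant_setting theta Phi k m n ->
       C <= lam theta n -> lam theta m <= - C ->
       C * `|lam theta k| <= lam theta n ->
       forall i : subsystem, exists2 a : R -> 'rV[R]_3,
         solution (euler_rhs theta Phi (member i k) (member i m) (member i n)) a &
         forall s : R, 1 <= s -> exists2 t : R, 0 < t < tau &
           M < Hs_sqr theta (member i k) (member i m) (member i n) s (a t)
               / Hs_sqr theta (member i k) (member i m) (member i n) s (a 0)).
Proof.
split=> [theta Phi k m n setting kn mk A A0 Adiff|M tau tau0].
  exact: (disjoint_homoclinic_cycles setting).
(* This choice gives [C >= 4] and [C^2 >= 4 C > 13 |M|], so that [C^2 / 13] exceeds [M]; the bound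
   [tau] is met through the amplitude of the orbit. *)
have nM := normr_ge0 M; pose C := 4 + 13 * `|M|.
have C4 : 4 <= C by rewrite lerDl; lra.
exists C => [|theta Phi k m n setting Cn mC Ckn i]; first lra.
have [a sol burst] := bursting_orbit setting i tau0 C4 Cn mC Ckn.
exists a => // s s1; have [t ttau bound] := burst s s1; exists t => //.
apply: (lt_le_trans _ bound); rewrite ltr_pdivlMr // (le_lt_trans (y := 13 * `|M|)) //.
  by rewrite mulrC ler_pM2l // ler_norm.
by rewrite /C; nra.
Qed.
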